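(* Let $\mathcal{V}_1$ and $\mathcal{V}_2$ be two varieties of universal algebras. Let $X$ be an infinite set and let $\Theta_1^0(X)$, $\Theta_2^0(X)$ be the two corresponding categories of free algebras over finite subsets of $X$. Then every equivalence $\Theta_1^0(X)\to\Theta_2^0(X)$ is isomorphic (as a functor) to an isomorphism of categories $\Theta_1^0(X)\to\Theta_2^0(X)$. Thus if these categories are equivalent, they are isomorphic. Further, for a category of the kind $\Theta^0(X)$ (associated with a variety $\mathcal{V}$ of universal algebras and an infinite set $X$), every autoequivalence of it is isomorphic (as a functor) to an automorphism of this category.
   Context: For a variety $\mathcal{V}$ of universal algebras and an infinite set $X$, to every finite subset $X_0\subset X$ there corresponds the free $\mathcal{V}$-algebra $W(X_0)$ freely generated by $X_0$. The category $\Theta^0(X)$ has as objects all these free algebras $W(X_0)$, $X_0$ ranging over the finite subsets of $X$ (distinct finite subsets being regarded as giving distinct objects), and as morphisms all homomorphisms of $\mathcal{V}$-algebras between them. $\Theta_i^0(X)$ denotes this category for $\mathcal{V}=\mathcal{V}_i$, $i=1,2$. A functor $F:\mathcal{C}\to\mathcal{D}$ is called an equivalence if it is full and faithful and every object of $\mathcal{D}$ is isomorphic to $F(A)$ for some object $A$ of $\mathcal{C}$; an autoequivalence of $\mathcal{C}$ is an equivalence $\mathcal{C}\to\mathcal{C}$. An isomorphism of categories is a functor having a two-sided inverse functor (strictly); an automorphism of $\mathcal{C}$ is an isomorphism $\mathcal{C}\to\mathcal{C}$. Two functors are isomorphic if there is a natural isomorphism between them. *)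

(* Defs.v *)
From mathcomp Require Import all_boot.
From mathcomp Require Import boolp classical_sets cardinality.

Set Implicit Arguments.
Unset Strict Implicit.
Unset Printing Implicit Defensive.

Local Open Scope classical_set_scope.

(** * Categories *)

Record category := Category {
  obj :> Type;
  hom : obj -> obj -> Type;
  idm : forall a, hom a a;
  compm : forall a b c, hom b c -> hom a b -> hom a c;
  compm1 : forall a b (f : hom a b), compm f (idm a) = f;
  comp1m : forall a b (f : hom a b), compm (idm b) f = f;
  compmA : forall a b c d (h : hom c d) (g : hom b c) (f : hom a b),
    compm h (compm g f) = compm (compm h g) f
}.
Arguments hom {C} a b : rename.
Arguments idm {C} a : rename.
Arguments compm {C a b c} g f : rename.

Definition is_iso (C : category) (a b : C) (f : hom a b) : Prop :=
  exists g : hom b a, compm g f = idm a /\ compm f g = idm b.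

Definition iso_objects (C : category) (a b : C) : Prop :=
  exists f : hom a b, is_iso f.

Record functor (C D : category) := Functor {
  fobj :> C -> D;
  fmap : forall a b : C, hom a b -> hom (fobj a) (fobj b);
  fmap1 : forall a, fmap (idm a) = idm (fobj a);
  fmapM : forall a b c (g : hom b c) (f : hom a b),
    fmap (compm g f) = compm (fmap g) (fmap f)
}.
Arguments fmap {C D} F {a b} f : rename.

Lemma id_functor1 (C : category) (a : C) : idm a = idm a.
Proof. by []. Qed.

Definition id_functor (C : category) : functor C C :=
  @Functor C C id (fun _ _ f => f) (@id_functor1 C) (fun _ _ _ _ _ => erefl).

Section FunctorComposition.
Variables (C D E : category) (G : functor D E) (F : functor C D).

Lemma comp_functor1 (a : C) : fmap G (fmap F (idm a)) = idm (G (F a)).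
Proof. by rewrite !fmap1. Qed.

Lemma comp_functorM (a b c : C) (g : hom b c) (f : hom a b) :
  fmap G (fmap F (compm g f)) =
  compm (fmap G (fmap F g)) (fmap G (fmap F f)).
Proof. by rewrite !fmapM. Qed.

Definition comp_functor : functor C E :=
  @Functor C E (fun a => G (F a)) (fun _ _ f => fmap G (fmap F f))
    comp_functor1 comp_functorM.
End FunctorComposition.

Definition full (C D : category) (F : functor C D) : Prop :=
  forall (a b : C) (g : hom (F a) (F b)), exists f : hom a b, fmap F f = g.

Definition faithful (C D : category) (F : functor C D) : Prop :=
  forall (a b : C) (f g : hom a b), fmap F f = fmap F g -> f = g.

Definition essentially_surjective (C D : category) (F : functor C D) : Prop :=
  forall d : D, exists c : C, iso_objects d (F c).

Definition is_equivalence (C D : category) (F : functor C D) : Prop :=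
  [/\ full F, faithful F & essentially_surjective F].

(* The equations are Leibniz equalities of functors: strict equality on objects
   and on morphisms, the proof fields being irrelevant. *)
Definition is_isomorphism (C D : category) (F : functor C D) : Prop :=
  exists G : functor D C,
    comp_functor G F = id_functor C /\ comp_functor F G = id_functor D.

Definition is_autoequivalence (C : category) (F : functor C C) : Prop :=
  is_equivalence F.

Definition is_automorphism (C : category) (F : functor C C) : Prop :=
  is_isomorphism F.

Definition iso_functors (C D : category) (F G : functor C D) : Prop :=
  exists eta : forall a : C, hom (F a) (G a),
    (forall a, is_iso (eta a)) /\
    (forall a b (f : hom a b),
       compm (eta b) (fmap F f) = compm (fmap G f) (eta a)).

Definition equivalent_categories (C D : category) : Prop :=
  exists F : functor C D, is_equivalence F.

Definition isomorphic_categories (C D : category) : Prop :=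
  exists F : functor C D, is_isomorphism F.

(** * Universal algebra *)

Record signature := Signature {
  operation :> Type;
  arity : operation -> nat
}.
Arguments arity {s} o : rename.

Inductive term (S : signature) (B : Type) : Type :=
| Var of B
| App (o : S) of ('I_(arity o) -> term S B).
Arguments Var S {B} b : rename.
Arguments App {S B} o args : rename.

(* The carrier may be empty. *)
Record algebra (S : signature) := Algebra {
  carrier :> Type;
  interp : forall o : S, ('I_(arity o) -> carrier) -> carrier
}.
Arguments interp {S A} o args : rename.

Fixpoint eval (S : signature) (B : Type) (A : algebra S) (v : B -> A)
    (t : term S B) : A :=
  match t with
  | Var b => v b
  | App o args => interp o (fun i => eval v (args i))
  end.

Record variety := Variety {
  sig :> signature;
  identities : set (term sig nat * term sig nat)
}.
Arguments identities : clear implicits.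

Definition satisfies (V : variety) (A : algebra V) : Prop :=
  forall s t, identities V (s, t) -> forall v : nat -> A, eval v s = eval v t.

Record valgebra (V : variety) := VAlgebra {
  valgebra_algebra :> algebra V;
  valgebraP : satisfies valgebra_algebra
}.

Record morphism (S : signature) (A B : algebra S) := Morphism {
  morphism_fun :> A -> B;
  morphismP : forall (o : S) (args : 'I_(arity o) -> A),
    morphism_fun (interp o args) = interp o (fun i => morphism_fun (args i))
}.

Section Morphisms.
Variable S : signature.

Lemma morphism_eq (A B : algebra S) (f g : morphism A B) : f =1 g -> f = g.
Proof.
case: f g => [f fP] [g gP] /= /funext fg.
by subst g; congr Morphism; exact: Prop_irrelevance.
Qed.

Definition id_morphism (A : algebra S) : morphism A A :=
  @Morphism S A A id (fun _ _ => erefl).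

Lemma comp_morphismP (A B C : algebra S) (g : morphism B C) (f : morphism A B)
    (o : S) (args : 'I_(arity o) -> A) :
  g (f (interp o args)) = interp o (fun i => g (f (args i))).
Proof. by rewrite !morphismP. Qed.

Definition comp_morphism (A B C : algebra S) (g : morphism B C)
    (f : morphism A B) : morphism A C :=
  @Morphism S A C (fun x => g (f x)) (comp_morphismP g f).

Lemma comp_morphism1 (A B : algebra S) (f : morphism A B) :
  comp_morphism f (id_morphism A) = f.
Proof. exact: morphism_eq. Qed.

Lemma comp_1morphism (A B : algebra S) (f : morphism A B) :
  comp_morphism (id_morphism B) f = f.
Proof. exact: morphism_eq. Qed.

Lemma comp_morphismA (A B C D : algebra S) (h : morphism C D)
    (g : morphism B C) (f : morphism A B) :
  comp_morphism h (comp_morphism g f) = comp_morphism (comp_morphism h g) f.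
Proof. exact: morphism_eq. Qed.
End Morphisms.

(* [gen] is not required to be injective: it fails to be so for the variety
   defined by the identity x = y. *)
Definition freely_generated (V : variety) (B : Type) (A : valgebra V)
    (gen : B -> A) : Prop :=
  forall (C : valgebra V) (f : B -> C),
    exists! h : morphism A C, forall b, h (gen b) = f b.

Record free_algebra (V : variety) (B : Type) := FreeAlgebra {
  free_valgebra :> valgebra V;
  free_gen : B -> free_valgebra;
  free_algebraP : freely_generated free_gen
}.

(** ** Existence of free algebras *)

Section FreeAlgebraExists.
Variables (V : variety) (B : Type).

Definition term_equiv (s t : term V B) : Prop :=
  forall (A : valgebra V) (v : B -> A), eval v s = eval v t.

Definition term_quot : Type := {c : set (term V B) | exists t, c = term_equiv t}.

Definition term_class (t : term V B) : term_quot :=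
  exist _ (term_equiv t) (ex_intro _ t erefl).

Definition term_repr (c : term_quot) : term V B := sval (cid (svalP c)).

Lemma term_classP (s t : term V B) :
  term_class s = term_class t <-> term_equiv s t.
Proof.
split=> [/(congr1 sval) /= st|st].
  by have : term_equiv t t by []; rewrite -st.
apply: eq_exist; apply/funext => u; apply/propext.
by split=> e A v; [rewrite -st e|rewrite st e].
Qed.

Lemma term_reprK (c : term_quot) : term_class (term_repr c) = c.
Proof.
rewrite /term_repr; case: cid => t /= ct.
by case: c ct => c p /= ct; apply: eq_exist.
Qed.

Definition term_quot_algebra : algebra V :=
  @Algebra V term_quot
    (fun o args => term_class (App o (fun i => term_repr (args i)))).

Lemma interp_term_class (o : V) (args : 'I_(arity o) -> term V B) :
  @interp V term_quot_algebra o (fun i => term_class (args i)) =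
  term_class (App o args).
Proof.
apply/term_classP => A v /=; congr interp; apply/funext => i.
by have /term_classP := term_reprK (term_class (args i)); apply.
Qed.

Fixpoint subst (C : Type) (r : C -> term V B) (t : term V C) : term V B :=
  match t with
  | Var c => r c
  | App o args => App o (fun i => subst r (args i))
  end.

Lemma eval_subst (C : Type) (r : C -> term V B) (A : algebra V) (v : B -> A) t :
  eval v (subst r t) = eval (fun c => eval v (r c)) t.
Proof.
by elim: t => //= o args IH; congr interp; apply/funext => i; apply: IH.
Qed.

Lemma eval_term_class (C : Type) (r : C -> term V B) (t : term V C) :
  eval (A := term_quot_algebra) (fun c => term_class (r c)) t =
  term_class (subst r t).
Proof.
elim: t => // o args IH; rewrite [RHS]/= -interp_term_class.
rewrite [LHS]/eval -/eval; congr interp; apply/funext => i; exact: IH.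
Qed.

Lemma term_quotP : satisfies term_quot_algebra.
Proof.
move=> s t st v.
have -> : v = (fun n => term_class (term_repr (v n))).
  by apply/funext => n; rewrite term_reprK.
rewrite !eval_term_class; apply/term_classP => A w.
by rewrite !eval_subst; apply: valgebraP.
Qed.

Definition term_quot_valgebra : valgebra V := VAlgebra term_quotP.

Lemma term_quot_free :
  freely_generated (A := term_quot_valgebra) (fun b => term_class (Var V b)).
Proof.
move=> C f.
have evalK t : eval f (term_repr (term_class t)) = eval f t.
  by have /term_classP := term_reprK (term_class t); apply.
pose h (c : term_quot_valgebra) : C := eval f (term_repr c).
have hP (o : V) (args : 'I_(arity o) -> term_quot_valgebra) :
    h (interp o args) = interp o (fun i => h (args i)).
  by rewrite /h evalK.
exists (Morphism hP); split=> [b|g gP]; first by rewrite /= /h evalK.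
apply: morphism_eq => c; rewrite /= /h -{2}(term_reprK c).
elim: (term_repr c) => [b|o args IH] /=; first by rewrite gP.
rewrite -interp_term_class (morphismP g).
by congr interp; apply/funext => i; apply: IH.
Qed.

Definition term_quot_free_algebra : free_algebra V B :=
  FreeAlgebra term_quot_free.

End FreeAlgebraExists.

(** * The category of free algebras over finite subsets of [X] *)

Definition finite_subset (X : Type) : Type := {A : set X | finite_set A}.

(* A choice, for each finite subset [X0] of [X], of a free algebra W(X0)
   freely generated by the elements of [X0]. *)
Definition free_algebras (V : variety) (X : Type) : Type :=
  forall X0 : finite_subset X, free_algebra V (sval X0).

(* The objects are the finite subsets themselves, so that distinct subsets give
   distinct objects even when the chosen algebras coincide. *)
Definition Theta0 (V : variety) (X : Type) (W : free_algebras V X) : category :=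
  @Category (finite_subset X)
    (fun X0 Y0 => morphism (W X0) (W Y0))
    (fun X0 => id_morphism (W X0))
    (fun X0 Y0 Z0 g f => comp_morphism g f)
    (fun X0 Y0 f => comp_morphism1 f)
    (fun X0 Y0 f => comp_1morphism f)
    (fun X0 Y0 Z0 T0 h g f => comp_morphismA h g f).

(* Main.v *)
Require Import Defs.
From mathcomp Require Import all_boot.
From mathcomp Require Import boolp classical_sets functions cardinality.

(** Let [F] be an equivalence between two categories of free algebras.  An
    object is a finite subset [a] of [X], and [F] is isomorphic to an isomorphism
    of categories as soon as some bijection [phi] between the objects satisfies
    [phi a] isomorphic to [F a] for all [a]: transporting [F] along such
    isomorphisms yields a fully faithful functor that is bijective on objects
    ([transport_functor], [fully_faithful_bijective_isomorphism]).

    To find [phi] it suffices, by the Cantor-Bernstein argument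
    ([bernstein_compatible]), to find injections [f] and [g] on finite subsets
    such that [f a] is isomorphic to [F a] and [b] is isomorphic to [F (g b)].
    The isomorphism type of a free algebra depends only on the number of its
    generators, and an infinite [X] has room for an injection [f] that replaces
    each [a] by a subset of any prescribed size [m a], provided that the size
    does not decrease ([finite_subset_inflation]).  So what is needed is that
    [F a] is isomorphic to a free algebra on at least as many generators as [a],
    and likewise in the other direction.

    This comes from copowers.  The free algebra on [n * p] generators is the
    [n]-fold copower of the free algebra on [p] generators ([Theta0_copower]),
    and equivalences preserve copowers ([equivalence_copower]).  Hence if [F]
    sends the free algebra on one generator to one on [p] generators, it sends a
    free algebra on [n] generators to one on [n * p], and [n <= n * p] unless
    [p = 0].  In that exceptional case every object of the target category is
    isomorphic to the initial one, so that any size will do.  The preimage of the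
    free algebra on one generator gives the other direction in the same way. *)

Set Implicit Arguments.
Unset Strict Implicit.
Unset Printing Implicit Defensive.

Local Open Scope classical_set_scope.
Local Open Scope card_scope.

(** * Isomorphisms of objects and equality of functors *)

Lemma compm_cancel (C : category) (a b c : C) (g : hom b a) (h : hom a b) :
  compm h g = idm b -> forall f : hom c b, compm h (compm g f) = f.
Proof. by move=> hg f; rewrite compmA hg comp1m. Qed.

Lemma iso_objects_refl (C : category) (a : C) : iso_objects a a.
Proof. by exists (idm a), (idm a); rewrite !comp1m. Qed.

Lemma iso_objects_sym (C : category) (a b : C) :
  iso_objects a b -> iso_objects b a.
Proof. by move=> [f [g [gf fg]]]; exists g, f. Qed.

Lemma iso_objects_trans (C : category) (b a c : C) :
  iso_objects a b -> iso_objects b c -> iso_objects a c.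
Proof.
move=> [f [f' [f'f ff']]] [g [g' [g'g gg']]].
exists (compm g f), (compm f' g'); split.
  by rewrite -compmA (compm_cancel g'g).
by rewrite -compmA (compm_cancel ff').
Qed.

Section IdToHom.
Context {C : category}.

(** Strict equality of functors compares morphisms whose types agree only up to
    equality of objects.  Turning these equalities into isomorphisms replaces
    casts by compositions. *)
Definition idtohom {a b : C} (p : a = b) : hom a b :=
  match p in _ = y return hom a y with erefl => idm a end.

Lemma idtohom_comp (a b c : C) (p : a = b) (q : b = c) (r : a = c) :
  compm (idtohom q) (idtohom p) = idtohom r.
Proof. by subst; rewrite (Prop_irrelevance r erefl) /= comp1m. Qed.

Lemma idtohom_id (a : C) (p : a = a) : idtohom p = idm a.
Proof. by rewrite (Prop_irrelevance p erefl). Qed.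

End IdToHom.

Lemma fmap_idtohom {C D : category} (F : functor C D) (a b : C) (p : a = b)
    (q : F a = F b) : fmap F (idtohom p) = idtohom q.
Proof. by subst b; rewrite (Prop_irrelevance q erefl) /= fmap1. Qed.

(** A natural transformation whose components are identities up to equality of
    objects witnesses a strict equality of functors. *)
Lemma functor_eq (C D : category) (F G : functor C D) (p : forall a, F a = G a) :
  (forall a b (f : hom a b),
    compm (idtohom (p b)) (fmap F f) = compm (fmap G f) (idtohom (p a))) ->
  F = G.
Proof.
case: F G p => F0 F1 F1i F1M [G0 G1 G1i G1M] /= p nat.
have FG : F0 = G0 by apply/funext.
subst G0.
have FG : F1 = G1.
  apply: functional_extensionality_dep => a.
  apply: functional_extensionality_dep => b; apply/funext => f.
  by move: (nat a b f); rewrite !idtohom_id comp1m compm1.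
subst G1; congr Functor; exact: Prop_irrelevance.
Qed.

(** Fullness lifts the conjugate of [g : hom d e] by the isomorphisms
    [G (psi d) = d], where [psi] is the inverse of [G] on objects; faithfulness
    makes the lift unique, hence functorial and inverse to [G] on morphisms. *)
Lemma fully_faithful_bijective_isomorphism (C D : category) (G : functor C D) :
  full G -> faithful G -> bijective G -> is_isomorphism G.
Proof.
move=> fullG faithG [psi psiK phiK].
pose up (d : D) : hom (G (psi d)) d := idtohom (phiK d).
pose down (d : D) : hom d (G (psi d)) := idtohom (esym (phiK d)).
have upK d : compm (up d) (down d) = idm d.
  by rewrite (idtohom_comp _ _ erefl).
have downK d : compm (down d) (up d) = idm (G (psi d)).
  by rewrite (idtohom_comp _ _ erefl).
pose lift d e (g : hom d e) :=
  cid (fullG (psi d) (psi e) (compm (down e) (compm g (up d)))).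
pose H1 d e (g : hom d e) : hom (psi d) (psi e) := sval (lift d e g).
have GH1 d e (g : hom d e) : fmap G (H1 d e g) = compm (down e) (compm g (up d)).
  exact: (svalP (lift d e g)).
have H1i d : H1 d d (idm d) = idm (psi d).
  by apply: faithG; rewrite GH1 fmap1 comp1m downK.
have H1M d e k (g : hom e k) (f : hom d e) :
    H1 d k (compm g f) = compm (H1 e k g) (H1 d e f).
  apply: faithG; rewrite fmapM !GH1 -!compmA.
  by rewrite (compm_cancel (upK _)).
pose H := Functor H1i H1M; exists H; split.
- apply: (@functor_eq _ _ (comp_functor H G) (id_functor C) psiK) => a b f /=.
  apply: faithG; rewrite !fmapM GH1.
  rewrite (fmap_idtohom _ (phiK _)) (fmap_idtohom _ (phiK _)).
  by rewrite (compm_cancel (upK _)).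
- apply: (@functor_eq _ _ (comp_functor G H) (id_functor D) phiK) => d e g /=.
  by rewrite GH1 (compm_cancel (upK _)).
Qed.

(** The new functor sends [f : hom a b] to the conjugate of [fmap F f] by the
    chosen isomorphisms, which are then natural by construction. *)
Lemma transport_functor (C D : category) (F : functor C D) (phi : C -> D) :
  is_equivalence F -> bijective phi -> (forall a, iso_objects (F a) (phi a)) ->
  exists2 G : functor C D, is_isomorphism G & iso_functors F G.
Proof.
move=> [fullF faithF _] phi_bij /(_ _)/cid iso.
pose u a : hom (F a) (phi a) := sval (iso a).
have u_iso a : is_iso (u a) := svalP (iso a).
pose v a : hom (phi a) (F a) := sval (cid (u_iso a)).
have [vu uv] : (forall a, compm (v a) (u a) = idm _) /\
    (forall a, compm (u a) (v a) = idm _).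
  by split=> a; case: (svalP (cid (u_iso a))).
pose G1 a b (f : hom a b) : hom (phi a) (phi b) :=
  compm (u b) (compm (fmap F f) (v a)).
have G1i a : G1 a a (idm a) = idm (phi a) by rewrite /G1 fmap1 comp1m uv.
have G1M a b c (g : hom b c) (f : hom a b) :
    G1 a c (compm g f) = compm (G1 b c g) (G1 a b f).
  by rewrite /G1 fmapM -!compmA (compm_cancel (vu _)).
have G1K a b (f : hom a b) : compm (v b) (compm (G1 a b f) (u a)) = fmap F f.
  by rewrite /G1 -!compmA vu compm1 (compm_cancel (vu _)).
pose G := Functor G1i G1M; exists G.
- apply: fully_faithful_bijective_isomorphism => // a b.
  + move=> g; have [f fE] := fullF a b (compm (v b) (compm g (u a))).
    exists f; rewrite /= /G1 fE -!compmA uv compm1.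
    by rewrite (compm_cancel (uv _)).
  + by move=> f g /= fg; apply: faithF; rewrite -[LHS]G1K fg G1K.
- exists u; split=> // a b f /=.
  by rewrite /G1 -!compmA vu compm1.
Qed.

(** * Copowers *)

(** [b] is the coproduct of a family, indexed by [I], of copies of [c], with
    coprojections [inj]. *)
Definition is_copower {C : category} {I : Type} (c b : C) (inj : I -> hom c b) :=
  forall (d : C) (f : I -> hom c d),
    exists! h : hom b d, forall i, compm h (inj i) = f i.
Arguments is_copower {C I c b} inj.

Lemma copower_unique (C : category) (I : Type) (c b b' : C)
    (inj : I -> hom c b) (inj' : I -> hom c b') :
  is_copower inj -> is_copower inj' -> iso_objects b b'.
Proof.
move=> P P'.
have endo x (k : I -> hom c x) : is_copower k ->
    forall h, (forall i, compm h (k i) = k i) -> h = idm x.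
  move=> Pk h hk; have [h0 [_ uniq]] := Pk x k.
  by rewrite -(uniq h) // -(uniq (idm x)) // => i; rewrite comp1m.
have [u [uP _]] := P _ inj'; have [v [vP _]] := P' _ inj.
exists u, v; split.
- by apply: (endo _ _ P) => i; rewrite -compmA uP vP.
- by apply: (endo _ _ P') => i; rewrite -compmA vP uP.
Qed.

Lemma copower_iso_base (C : category) (I : Type) (c c' b : C) (inj : I -> hom c b)
    (u : hom c' c) :
  is_iso u -> is_copower inj -> is_copower (fun i => compm (inj i) u).
Proof.
move=> [v [vu uv]] P d f.
have [h [hP uniq]] := P d (fun i => compm (f i) v).
exists h; split=> [i|k kP]; first by rewrite compmA hP -compmA vu compm1.
by apply: uniq => i; rewrite -kP -!compmA uv compm1.
Qed.

(** A test object of [D] is isomorphic to some [F d'], and maps between objects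
    in the image of [F] correspond to maps in [C]. *)
Lemma equivalence_copower (C D : category) (F : functor C D) (I : Type) (c b : C)
    (inj : I -> hom c b) :
  is_equivalence F -> is_copower inj -> is_copower (fun i => fmap F (inj i)).
Proof.
move=> [fullF faithF esF] P d f.
have [d' [u [v [vu uv]]]] := esF d.
have [f' f'P] : {f' : I -> hom c d' & forall i, fmap F (f' i) = compm u (f i)}.
  exists (fun i => sval (cid (fullF c d' (compm u (f i))))) => i.
  exact: (svalP (cid (fullF c d' (compm u (f i))))).
have [h [hP uniq]] := P d' f'.
exists (compm v (fmap F h)); split=> [i|k kP].
  by rewrite -compmA -fmapM hP f'P (compm_cancel vu).
have [k' k'P] := @fullF _ _ (compm u k).
suff -> : h = k' by rewrite k'P (compm_cancel vu).
apply: uniq => i; apply: faithF.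
by rewrite fmapM k'P -compmA kP f'P.
Qed.

(** * Combinatorics of finite subsets *)

(** The Cantor-Bernstein bijection agrees at each point either with [f] or with
    an inverse of [g], so it inherits any relation satisfied by both. *)
Lemma bernstein_compatible (T U : Type) (R : T -> U -> Prop) (f : T -> U)
    (g : U -> T) :
  injective f -> injective g ->
  (forall x, R x (f x)) -> (forall y, R (g y) y) ->
  exists2 h : T -> U, bijective h & forall x, R x (h x).
Proof.
move=> f_inj g_inj Rf Rg.
(* [S] collects the points whose backward orbit stops outside the image of [g];
   they have to be mapped by [f], the others by the inverse of [g]. *)
pose orbit n x := iter n (g \o f) x.
pose S : set T := [set x | exists n y, (forall z, g z <> y) /\ x = orbit n y].
have notS x : ~ S x -> exists y, g y = x.
  move=> nSx; apply: contrapT => nex; apply: nSx; exists 0%N, x; split=> //.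
  by move=> z gz; apply: nex; exists z.
have Sgf x : S (g (f x)) <-> S x.
  split=> [[[|n] [y [ny E]]]|[n [y [ny ->]]]].
  - by case: (ny (f x)).
  - by exists n, y; split=> //; apply/f_inj/g_inj.
  - by exists n.+1, y.
pose h x := if pselect (S x) is right nSx then sval (cid (notS x nSx)) else f x.
have hS x : S x -> h x = f x by rewrite /h; case: pselect.
have hN x : ~ S x -> g (h x) = x.
  by rewrite /h; case: pselect => // nSx _; apply: (svalP (cid (notS x nSx))).
exists h; last first.
  move=> x; have [/hS ->//|/hN gh] := pselect (S x).
  by rewrite -{1}gh.
have h_inj : injective h.
  move=> x y; have [Sx|nSx] := pselect (S x); have [Sy|nSy] := pselect (S y).
  - by rewrite !hS // => /f_inj.
  - rewrite (hS x) // => fx; case: (nSy).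
    by rewrite -(hN y nSy) -fx; apply/Sgf.
  - rewrite (hS y) // => fy; case: (nSx).
    by rewrite -(hN x nSx) fy; apply/Sgf.
  - by move=> hxy; rewrite -(hN x) // hxy hN.
have h_surj y : exists x, h x = y.
  have [[n [z [nz E]]]|nS] := pselect (S (g y)); last first.
    by exists (g y); apply: g_inj; rewrite hN.
  case: n E => [E|n E]; first by case: (nz y).
  exists (orbit n z); rewrite hS; last by exists n, z.
  by apply: g_inj.
have [k kP] : {k : U -> T & forall y, h (k y) = y}.
  exists (fun y => sval (cid (h_surj y))) => y.
  exact: (svalP (cid (h_surj y))).
by exists k => // x; apply: h_inj; rewrite kP.
Qed.

Lemma eq_card_bijective (A B : finType) :
  #|A| = #|B| -> exists f : A -> B, bijective f.
Proof.
move=> AB; exists (fun x => enum_val (cast_ord AB (enum_rank x))).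
exact: bij_comp (@enum_val_bij B)
  (bij_comp (Bijective (cast_ordK AB) (cast_ordKV AB)) (@enum_rank_bij A)).
Qed.

Section Size.
Context {X : Type}.
Implicit Types a b c : finite_subset X.

Definition fsize a : nat := sval (cid (svalP a)).

Lemma fsizeP a : sval a #= `I_(fsize a).
Proof. exact: (svalP (cid (svalP a))). Qed.

Lemma fsize_eq a n : sval a #= `I_n -> fsize a = n.
Proof.
by move=> an; apply/card_eq_II; rewrite -(card_eql (fsizeP a)).
Qed.

Lemma fsize_enum a : exists u : 'I_(fsize a) -> sval a, bijective u.
Proof.
have /card_bijP[u [v vK uK]] : [set: 'I_(fsize a)] #= sval a.
  by rewrite -(card_eql card_II) card_eq_sym; exact: fsizeP.
exists (u \o to_setT); apply: bij_comp; first by exists v.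
exact: bijTT.
Qed.

Lemma fsize_prod b c n : fsize b = (n * fsize c)%N ->
  exists t : 'I_n * sval c -> sval b, bijective t.
Proof.
move=> bE; have [u ubij] := fsize_enum b; have [v [w wK vK]] := fsize_enum c.
have [r r_bij] : exists r : 'I_n * 'I_(fsize c) -> 'I_(fsize b), bijective r.
  by apply: eq_card_bijective; rewrite card_prod !card_ord.
have pair_bij : bijective (fun z : 'I_n * sval c => (z.1, w z.2)).
  by exists (fun z => (z.1, v z.2)) => -[i x] /=; rewrite ?vK ?wK.
exists (fun z => u (r (z.1, w z.2))).
exact: bij_comp ubij (bij_comp r_bij pair_bij).
Qed.

End Size.

(** Along an injection [e] of [nat] into [X], the points of its image move to
    even positions, which frees the odd ones. *)
Lemma infinite_hilbert_hotel (X : Type) : infinite_set [set: X] ->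
  exists s : X + nat -> X, injective s.
Proof.
move=> /infiniteP/card_leP[f].
pose e (n : nat) : X := val (f (to_setT n)).
have e_inj : injective e.
  move=> m n /val_inj /inj E.
  by have := E (mem_set I) (mem_set I) => /(congr1 val).
exists (fun z => match z with
  | inl x => if pselect (exists n, e n = x) is left h
             then e (sval (cid h)).*2 else x
  | inr n => e n.*2.+1 end).
have E x (h : exists n, e n = x) : e (sval (cid h)) = x by exact: (svalP (cid h)).
move=> [x|m] [y|n].
- case: pselect => [p|np]; case: pselect => [q|nq].
  + by move=> /e_inj/double_inj pq; rewrite -(E x p) -(E y q) pq.
  + by move=> pq; case: nq; eexists; exact: pq.
  + by move=> pq; case: np; eexists; exact/esym/pq.
  + by move=> ->.
- case: pselect => [p|np].
  + by move=> /e_inj/(congr1 odd); rewrite /= !odd_double.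
  + by move=> pq; case: np; eexists; exact/esym/pq.
- case: pselect => [p|np].
  + by move=> /e_inj/(congr1 odd); rewrite /= !odd_double.
  + by move=> pq; case: np; eexists; exact/pq.
- by move=> /e_inj [/double_inj ->].
Qed.

(** Through an injection [s] of [X + nat] into [X], pad the copy of [a] with as
    many naturals as needed: [a] is recovered from the result as its
    preimage in [X], whatever [m] is. *)
Lemma finite_subset_inflation (X : Type) (m : finite_subset X -> nat) :
  infinite_set [set: X] -> (forall a, fsize a <= m a)%N ->
  exists2 f : finite_subset X -> finite_subset X,
    injective f & forall a, fsize (f a) = m a.
Proof.
move=> /infinite_hilbert_hotel[s s_inj] le_m.
pose u (a : finite_subset X) : 'I_(fsize a) -> sval a := sval (cid (fsize_enum a)).
have u_bij a : bijective (u a) by exact: (svalP (cid (fsize_enum a))).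
pose w (a : finite_subset X) (i : 'I_(fsize a) + 'I_(m a - fsize a)) : X :=
  s (match i with inl i => inl (val (u a i)) | inr j => inr (val j) end).
have w_inj a : injective (w a).
  move=> [i|i] [j|j] /s_inj [] // => [/val_inj|/val_inj -> //].
  by move=> /(bij_inj (u_bij a)) ->.
have w_card a : range (w a) #= `I_(m a).
  rewrite (card_eql (inj_card_eq (in2W (@w_inj a)))) card_eq_sym.
  rewrite (card_eql card_II).
  have [r r_bij] : exists r : 'I_(m a) ->
      'I_(fsize a) + 'I_(m a - fsize a), bijective r.
    by apply: eq_card_bijective; rewrite card_sum !card_ord subnKC.
  have [r' _] := PbijTT r_bij; exact: pcard_eq r'.
pose f a : finite_subset X := exist _ (range (w a)) (ex_intro _ (m a) (w_card a)).
exists f => [a b fab|a]; last exact/fsize_eq/w_card.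
have memf c x : sval c x <-> sval (f c) (s (inl x)).
  split=> [xc|[[i|i] _ /s_inj //]].
    have [v _ vK] := u_bij c.
    by exists (inl (v (exist _ x (mem_set xc)))) => //; rewrite /w vK.
  by move=> [<-]; apply: set_valP.
have ab : sval a = sval b.
  by apply/funext => x; apply/propext; rewrite (memf a) (memf b) fab.
by case: a b ab {fab} => [a a_fin] [b b_fin]; apply: eq_exist.
Qed.

(** * Free algebras and equivalences between their categories *)

Lemma free_hom_eq (V : variety) (B : Type) (A : free_algebra V B)
    (C : valgebra V) (f g : morphism A C) :
  (forall x, f (free_gen A x) = g (free_gen A x)) -> f = g.
Proof.
move=> fg; have [h [_ uniq]] := @free_algebraP _ _ A C (fun x => g (free_gen A x)).
by rewrite -(uniq f) // -(uniq g).
Qed.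

(** A bijection [t] of ['I_n * c] with [b] splits the generators of [W b] into
    [n] copies of those of [W c].  For [n = 0] this says that the free algebra on
    the empty set is initial. *)
Lemma Theta0_copower (V : variety) (X : Type) (W : free_algebras V X)
    (n : nat) (b c : Theta0 W) : fsize b = (n * fsize c)%N ->
  exists inj : 'I_n -> hom c b, is_copower inj.
Proof.
move=> bE; have [t [t' t'K tK]] := @fsize_prod _ b c n bE.
have ext (a : Theta0 W) (d : valgebra V) (f : sval a -> d) :
    {h : morphism (W a) d | forall x, h (free_gen (W a) x) = f x}.
  apply: cid; have [h [hP _]] := @free_algebraP _ _ (W a) d f.
  by exists h.
exists (fun i => sval (ext c (W b) (fun x => free_gen (W b) (t (i, x))))) => d f.
have [h hP] := ext b (W d)
  (fun y => (f (t' y).1 : morphism _ _) (free_gen (W c) (t' y).2)).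
exists h; split=> [i|k kP]; apply: free_hom_eq => x.
  by rewrite /= (svalP (ext c _ _)) hP t'K.
rewrite hP -(kP (t' x).1) /= (svalP (ext c _ _)).
by rewrite -surjective_pairing tK.
Qed.

Section Sizes.
Variables (V1 V2 : variety) (X : Type).
Variables (W1 : free_algebras V1 X) (W2 : free_algebras V2 X).
Variables (F : functor (Theta0 W1) (Theta0 W2)).
Hypotheses (X_inf : infinite_set [set: X]) (F_eqv : is_equivalence F).

Lemma fsize1_exists : exists c : finite_subset X, fsize c = 1%N.
Proof.
have [x _] := infinite_setN0 X_inf.
exists (exist _ [set x] (finite_set1 x)); apply: fsize_eq => /=.
exact: card_set1.
Qed.

(** Both [F a] and [b] are [n]-fold copowers of [c']. *)
Lemma copower_image (c a : Theta0 W1) (c' b : Theta0 W2) (n : nat) :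
  iso_objects c' (F c) -> fsize a = (n * fsize c)%N ->
  fsize b = (n * fsize c')%N -> iso_objects (F a) b.
Proof.
move=> [u u_iso] /Theta0_copower[ia iaP] /Theta0_copower[ib ibP].
exact: copower_unique
  (copower_iso_base u_iso (equivalence_copower F_eqv iaP)) ibP.
Qed.

(** The degenerate case: both categories have a single isomorphism class. *)
Lemma all_iso_image (z : Theta0 W2) :
  (forall d, iso_objects d z) -> forall a b, iso_objects (F a) b.
Proof.
by move=> zP a b; apply: iso_objects_trans (zP _) (iso_objects_sym (zP _)).
Qed.

(** If the image of the free algebra on one generator has [p > 0] generators,
    [m] is [p] times the size of [a]. *)
Lemma image_iso_not_smaller (a : Theta0 W1) : exists2 m, (fsize a <= m)%N &
  forall b : Theta0 W2, fsize b = m -> iso_objects (F a) b.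
Proof.
have [c c1] := fsize1_exists.
have R a' b : fsize b = (fsize a' * fsize (F c))%N -> iso_objects (F a') b.
  by apply: copower_image (iso_objects_refl _) _; rewrite c1 muln1.
have [p0|p_gt0] := posnP (fsize (F c)); last first.
  by exists (fsize a * fsize (F c))%N => [|b /R//]; rewrite leq_pmulr.
(* [F] sends the free algebra on one generator to the initial object, whose
   copowers are all initial. *)
exists (fsize a) => // b _; apply: (@all_iso_image (F c)) => d.
have [_ _ /(_ d)[d' dd']] := F_eqv.
by apply: iso_objects_trans dd' (R _ _ _); rewrite p0 muln0.
Qed.

(** The roles of the two categories are exchanged by essential surjectivity: the
    free algebra on one generator of the target is some [F c] up to isomorphism,
    and copowers of [c] are sent to its copowers. *)
Lemma preimage_iso_not_smaller (b : Theta0 W2) : exists2 m, (fsize b <= m)%N &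
  forall a : Theta0 W1, fsize a = m -> iso_objects (F a) b.
Proof.
have [c' c'1] := fsize1_exists.
have [_ _ /(_ c')[c c'c]] := F_eqv.
have R a b' : fsize a = (fsize b' * fsize c)%N -> iso_objects (F a) b'.
  by move=> aE; apply: copower_image c'c aE _; rewrite c'1 muln1.
have [q0|q_gt0] := posnP (fsize c); last first.
  by exists (fsize b * fsize c)%N => [|a /R//]; rewrite leq_pmulr.
(* The free algebra on one generator is isomorphic to [F c] with [c] empty, an
   initial object, and so are its copowers. *)
exists (fsize b) => // a _; apply: (@all_iso_image (F c)) => d.
by apply/iso_objects_sym/R; rewrite q0 muln0.
Qed.

Lemma equivalence_iso_isomorphism :
  exists2 G : functor (Theta0 W1) (Theta0 W2),
    is_isomorphism G & iso_functors F G.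
Proof.
have [m m_ge mP] : {m : finite_subset X -> nat & (forall a, fsize a <= m a)%N &
    forall (a : Theta0 W1) (b : Theta0 W2), fsize b = m a -> iso_objects (F a) b}.
  exists (fun a => s2val (cid2 (image_iso_not_smaller a))) => a.
    exact: (s2valP (cid2 (image_iso_not_smaller a))).
  exact: (s2valP' (cid2 (image_iso_not_smaller a))).
have [k k_ge kP] : {m : finite_subset X -> nat & (forall a, fsize a <= m a)%N &
    forall (b : Theta0 W2) (a : Theta0 W1), fsize a = m b -> iso_objects (F a) b}.
  exists (fun a => s2val (cid2 (preimage_iso_not_smaller a))) => a.
    exact: (s2valP (cid2 (preimage_iso_not_smaller a))).
  exact: (s2valP' (cid2 (preimage_iso_not_smaller a))).
have [f f_inj fE] := finite_subset_inflation X_inf m_ge.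
have [g g_inj gE] := finite_subset_inflation X_inf k_ge.
have [phi phi_bij phiP] := bernstein_compatible
  (R := fun (a : Theta0 W1) (b : Theta0 W2) => iso_objects (F a) b)
  f_inj g_inj (fun a => mP _ _ (fE a)) (fun b => kP _ _ (gE b)).
exact: transport_functor F_eqv phi_bij phiP.
Qed.

End Sizes.

Theorem theorem3 :
  (forall (V1 V2 : variety) (X : Type), infinite_set [set: X] ->
   forall (W1 : free_algebras V1 X) (W2 : free_algebras V2 X),
     (forall F : functor (Theta0 W1) (Theta0 W2), is_equivalence F ->
        exists2 G : functor (Theta0 W1) (Theta0 W2),
          is_isomorphism G & iso_functors F G)
     /\ (equivalent_categories (Theta0 W1) (Theta0 W2) ->
         isomorphic_categories (Theta0 W1) (Theta0 W2)))
  /\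
  (forall (V : variety) (X : Type), infinite_set [set: X] ->
   forall (W : free_algebras V X) (F : functor (Theta0 W) (Theta0 W)),
     is_autoequivalence F ->
     exists2 G : functor (Theta0 W) (Theta0 W),
       is_automorphism G & iso_functors F G).
Proof.
split=> [V1 V2 X X_inf W1 W2|V X X_inf W F F_eqv].
- split=> [F F_eqv|[F F_eqv]]; first exact: equivalence_iso_isomorphism.
  by have [G G_iso _] := equivalence_iso_isomorphism X_inf F_eqv; exists G.
- exact: equivalence_iso_isomorphism.
Qed.
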